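(* Let the time evolution of an open quantum system described in a finite-dimensional Hilbert space $\mathcal{H}_S$ be governed by the Markovian master equation $$\dot\rho = -i[\hat H_{\rm eff},\rho] + L_D[\rho],\qquad L_D[\rho]=\frac12\sum_{l=1}^M\lambda_l\left([\hat J_l,\rho\hat J_l^\dagger]+[\hat J_l\rho,\hat J_l^\dagger]\right),$$ with time-independent $\hat H_{\rm eff}$. The space $$E_{\rm Jump}=\mathrm{span}\{|\psi_1\rangle,|\psi_2\rangle,\dots,|\psi_K\rangle\}$$ (with basis vectors $|\psi_1\rangle,\dots,|\psi_K\rangle$) is a decoherence-free subspace (DFS), in the sense of the definition given in the context, if and only if the basis vectors fulfill $$\hat J_l|\psi_k\rangle=c_l|\psi_k\rangle\quad\text{for all } l=1,\dots,M \text{ and all } k=1,\dots,K$$ (with complex numbers $c_l$ not depending on $k$) and $E_{\rm Jump}$ is invariant under $$\hat H_{\rm ev}=\hat H_{\rm eff}+\frac{i}{2}\sum_{l=1}^M\lambda_l\left(c_l^{*}\hat J_l-c_l\hat J_l^\dagger\right).$$ This guarantees identification of all DFS as well as explicit construction of all decoherence-free (DF) states.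
   Context: Setting: $\mathcal{H}_S$ is a finite-dimensional complex Hilbert space of dimension $N_S$, and $\rho(t)$ is the density matrix of the system on $\mathcal{H}_S$. $\hat H_{\rm eff}$ is a Hermitian operator on $\mathcal{H}_S$. The numbers $\lambda_1,\dots,\lambda_M>0$ are the positive eigenvalues of a time-independent positive semidefinite $(N_S^2-1)\times(N_S^2-1)$ matrix $A$ (so $M\le N_S^2-1$). The Lindblad (jump) operators $\hat J_l=\sum_k b_{lk}\hat F_k$ are time-independent linear operators on $\mathcal{H}_S$, where $(b_{lk})$ is a unitary matrix diagonalizing $A$ and $\hat F_1,\dots,\hat F_{N_S^2-1}$ together with the identity form a basis of the linear operators on $\mathcal{H}_S$. $[\cdot,\cdot]$ is the commutator and $c^*$ denotes the complex conjugate. A subspace $E$ is invariant under an operator $\hat H$ if $\hat H E\subseteq E$. For a Hilbert space $\mathcal{H}$, $D(\mathcal{H})$ denotes the set of all density matrices describing pure states of a quantum system associated with $\mathcal{H}$. Definition (decoherence-free subspace). Let the time evolution of an open quantum system with Hilbert space $\mathcal{H}_S$ be given by the master equation above. A decoherence-free subspace $\mathcal{H}_{\rm DFS}$ is a subspace of $\mathcal{H}_S$ such that all pure states $\rho(t)\in D(\mathcal{H}_{\rm DFS})$ fulfill $\partial_t\mathrm{Tr}[\rho^2(t)]=0$ for all $t\ge0$, with $\mathrm{Tr}[\rho^2(0)]=1$. The DF states are the states in such subspaces. *)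

(* Defs.v *)
From HB Require Import structures.
From mathcomp Require Export all_boot all_order all_algebra.
From mathcomp Require Export all_classical all_reals all_analysis.
From mathcomp Require Export complex.

Set Implicit Arguments.
Unset Strict Implicit.
Unset Printing Implicit Defensive.

Import Order.TTheory GRing.Theory Num.Theory.
Import numFieldNormedType.Exports.

Local Open Scope ring_scope.
Local Open Scope sesquilinear_scope.
Local Open Scope complex_scope.

(* The Hilbert space of dimension N is 'cV[R[i]]_N with the inner product
   <u|v> = u^t* *m v; operators are matrices acting on the left. *)

Definition psdmx (R : realType) (m : nat) (A : 'M[R[i]]_m) : Prop :=
  A \is hermsymmx /\
  forall x : 'cV[R[i]]_m, 0 <= (x ^t* *m A *m x) ord0 ord0.

(* Columns of b^T (that is, the rows of b) are orthonormal eigenvectors of A.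
   This is the convention for which the jump operators \sum_k b_lk F_k turn
   \sum_(j, k) A_jk ([F_j, rho F_k^+] + [F_j rho, F_k^+]) into its diagonal
   form \sum_l lam_l ([J_l, rho J_l^+] + [J_l rho, J_l^+]). *)
Definition diagonalizes (R : realType) (m : nat) (b A : 'M[R[i]]_m)
    (lam : 'I_m -> R) : Prop :=
  b \is unitarymx /\
  (b^T) ^t* *m A *m b^T = diag_mx (\row_l (lam l)%:C).

Definition jump_op (R : realType) (N m : nat) (b : 'M[R[i]]_m)
    (F : 'I_m -> 'M[R[i]]_N) (l : 'I_m) : 'M[R[i]]_N :=
  \sum_(k < m) b l k *: F k.

Definition mxcomm (R : realType) (N : nat) (X Y : 'M[R[i]]_N) : 'M[R[i]]_N :=
  X *m Y - Y *m X.

(* All sums over jump operators run over the first M indices of 'I_m: the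
   positive eigenvalues are listed first. *)
Definition dissipator (R : realType) (N m M : nat) (lam : 'I_m -> R)
    (J : 'I_m -> 'M[R[i]]_N) (rho : 'M[R[i]]_N) : 'M[R[i]]_N :=
  2^-1 *: \sum_(l < m | (l < M)%N) (lam l)%:C *:
    (mxcomm (J l) (rho *m (J l) ^t*) + mxcomm (J l *m rho) ((J l) ^t*)).

Definition master_rhs (R : realType) (N m M : nat) (Heff : 'M[R[i]]_N)
    (lam : 'I_m -> R) (J : 'I_m -> 'M[R[i]]_N) (rho : 'M[R[i]]_N)
    : 'M[R[i]]_N :=
  - 'i *: mxcomm Heff rho + dissipator M lam J rho.

Definition H_ev (R : realType) (N m M : nat) (Heff : 'M[R[i]]_N)
    (lam : 'I_m -> R) (J : 'I_m -> 'M[R[i]]_N) (c : 'I_m -> R[i])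
    : 'M[R[i]]_N :=
  Heff + ('i / 2) *: \sum_(l < m | (l < M)%N) (lam l)%:C *:
    ((c l)^* *: J l - c l *: (J l) ^t*).

(* R[i] is not a normed space over R in the library, hence derivatives of
   complex-valued functions of a real variable are taken componentwise. *)
Definition has_deriv (R : realType) (f : R -> R[i]) (t : R) (z : R[i]) : Prop :=
  is_derive t (1 : R) (fun s => complex.Re (f s)) (complex.Re z) /\
  is_derive t (1 : R) (fun s => complex.Im (f s)) (complex.Im z).

(* Only the values of rho at t >= 0 matter.  Asking for a two-sided derivative
   at t = 0 loses no solution: the equation is linear with constant
   coefficients, so every solution on [0, +oo[ extends to negative times. *)
Definition master_solution (R : realType) (N m M : nat) (Heff : 'M[R[i]]_N)
    (lam : 'I_m -> R) (J : 'I_m -> 'M[R[i]]_N) (rho : R -> 'M[R[i]]_N) : Prop :=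
  forall t : R, 0 <= t -> forall i j : 'I_N,
    has_deriv (fun s => rho s i j) t (master_rhs M Heff lam J (rho t) i j).

Definition pure_states (R : realType) (N : nat) (E : {vspace 'cV[R[i]]_N})
    : set 'M[R[i]]_N :=
  [set rho | exists v : 'cV[R[i]]_N,
    [/\ v \in E, v ^t* *m v = 1%:M & rho = v *m v ^t*]].

(* "All pure states rho(t) in D(E), for all t >= 0": every evolution that
   starts in D(E) remains in D(E) and has constant purity. Constant purity alone
   would not constrain E at all when there are no jump operators. *)
Definition is_DFS (R : realType) (N m M : nat) (Heff : 'M[R[i]]_N)
    (lam : 'I_m -> R) (J : 'I_m -> 'M[R[i]]_N) (E : {vspace 'cV[R[i]]_N})
    : Prop :=
  forall rho : R -> 'M[R[i]]_N,
    master_solution M Heff lam J rho -> pure_states E (rho 0) ->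
    \tr (rho 0 *m rho 0) = 1 /\
    forall t : R, 0 <= t ->
      pure_states E (rho t) /\ has_deriv (fun s => \tr (rho s *m rho s)) t 0.

Definition is_DF_state (R : realType) (N m M : nat) (Heff : 'M[R[i]]_N)
    (lam : 'I_m -> R) (J : 'I_m -> 'M[R[i]]_N) (rho : 'M[R[i]]_N) : Prop :=
  exists2 E : {vspace 'cV[R[i]]_N}, is_DFS M Heff lam J E & pure_states E rho.

Definition invariant_under (R : realType) (N : nat) (H : 'M[R[i]]_N)
    (E : {vspace 'cV[R[i]]_N}) : Prop :=
  forall v : 'cV[R[i]]_N, v \in E -> H *m v \in E.

Definition DFS_criterion (R : realType) (N m M K : nat) (Heff : 'M[R[i]]_N)
    (lam : 'I_m -> R) (J : 'I_m -> 'M[R[i]]_N)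
    (psi : K.-tuple 'cV[R[i]]_N) (c : 'I_m -> R[i]) : Prop :=
  (forall (l : 'I_m) (k : 'I_K), (l < M)%N ->
     J l *m tnth psi k = c l *: tnth psi k) /\
  invariant_under (H_ev M Heff lam J c) <<psi>>%VS.

(* Main.v *)
(** Necessity.  For a unit vector v, the purity of a solution starting at v v^+
    has initial derivative -2 \sum_l lam_l |J_l v - <v|J_l v> v|^2, so constant
    purity makes v an eigenvector of every J_l with lam_l > 0.  A linear map for
    which every vector of a subspace is an eigenvector is a scalar there, which
    gives c_l.  On such vectors the right-hand side of the master equation is
    -i [H_ev, v v^+]; since rho(t) v stays in E, its derivative at 0 lies in E,
    and therefore so does H_ev v.

    Sufficiency.  H_ev is Hermitian and preserves E, so the Schroedinger flow
    u' = -i H_ev u stays in the unit sphere of E.  Then u u^+ solves the master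
    equation, and it is the only solution with its initial value. *)

From HB Require Import structures.
Require Import Defs.
From mathcomp Require Import ring lra.

Set Implicit Arguments.
Unset Strict Implicit.
Unset Printing Implicit Defensive.

Import Order.TTheory GRing.Theory Num.Theory.
Import numFieldNormedType.Exports.

Local Open Scope ring_scope.
Local Open Scope sesquilinear_scope.
Local Open Scope complex_scope.

(** * Linear differential equations with constant coefficients *)

Lemma is_derive_bigsum (R : realType) (I : Type) (r : seq I) (f : I -> R -> R)
    (df : I -> R) (t : R) :
  (forall i, is_derive t (1 : R) (f i) (df i)) ->
  is_derive t (1 : R) (fun s => \sum_(i <- r) f i s) (\sum_(i <- r) df i).
Proof.
move=> fdf; elim: r => [|i r IHr].
  under eq_fun do rewrite big_nil.
  by rewrite big_nil; exact: is_derive_cst.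
under eq_fun do rewrite big_cons.
by rewrite big_cons; exact: is_deriveD.
Qed.

Lemma nincr_of_deriv_le0 (R : realType) (f df : R -> R) :
  (forall t : R, 0 <= t -> is_derive t (1 : R) f (df t)) ->
  (forall t : R, 0 <= t -> df t <= 0) ->
  forall t : R, 0 <= t -> f t <= f 0.
Proof.
move=> fdf df_le0 t t_ge0.
have derf (s : R) : 0 <= s -> derivable f s 1.
  by move=> s_ge0; have [] := fdf s s_ge0.
apply: (@ler0_derive1_le_cc _ _ 0 t); rewrite ?in_itv /= ?lexx ?t_ge0 //.
- by move=> s; rewrite in_itv /= => /andP[/ltW s_ge0 _]; exact: derf.
- move=> s; rewrite in_itv /= => /andP[/ltW s_ge0 _].
  have := fdf s s_ge0; rewrite derive1E => fs.
  by rewrite derive_val df_le0.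
- apply: derivable_within_continuous => s.
  by rewrite in_itv /= => /andP[s_ge0 _]; exact: derf.
Qed.

(** * Real linear systems: existence by the exponential series, uniqueness by an energy estimate *)

Section RealLinearODE.
Variables (R : realType) (I : finType) (A : I -> I -> R).

Let act (v : I -> R) (i : I) : R := \sum_j A i j * v j.

(** A crude bound that dominates every absolute row sum of [A], so powers of [A] grow at most like
    powers of [rate]. *)
Let rate : R := \sum_i \sum_j `|A i j|.

(** The Taylor coefficients of coordinate [i] of [exp(tA) v]. *)
Let term (v : I -> R) (i : I) (k : nat) : R := iter k act v i / k`!%:R.

Let rate_ge0 : 0 <= rate.
Proof. by apply: sumr_ge0 => i _; apply: sumr_ge0. Qed.

Let rate_row (i : I) : \sum_j `|A i j| <= rate.
Proof.
rewrite /rate [leRHS](bigD1 i) //= lerDl.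
by apply: sumr_ge0 => k _; apply: sumr_ge0.
Qed.

Let iter_act_le (v : I -> R) (k : nat) (i : I) :
  `|iter k act v i| <= rate ^+ k * \sum_j `|v j|.
Proof.
elim: k i => [|k IHk] i /=.
  by rewrite expr0 mul1r [leRHS](bigD1 i) //= lerDl sumr_ge0.
have d_ge0 : 0 <= rate ^+ k * \sum_j `|v j|.
  by apply: mulr_ge0; [exact: exprn_ge0 | exact: sumr_ge0].
rewrite exprS -mulrA (le_trans (ler_norm_sum _ _ _)) //.
apply: le_trans (ler_wpM2r d_ge0 (rate_row i)).
rewrite mulr_suml; apply: ler_sum => j _.
by rewrite normrM ler_wpM2l.
Qed.

(** Multiplying [A^(k+1) v / (k+1)!] by [k+1] leaves [A^k (A v) / k!]: differentiating the
    exponential series amounts to applying [A] to the initial vector. *)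
Let term_diffs (v : I -> R) (i : I) :
  pseries_diffs (term v i) = term (act v) i.
Proof.
apply/funext => k; rewrite /pseries_diffs /term -iterSr iterS factS natrM invfM.
by rewrite mulrCA mulVKf // pnatr_eq0.
Qed.

(** Absolute convergence by comparison with the series of [exp(rate * |x|)], scaled by the sum of
    the [|v j|]. *)
Let cvg_term (v : I -> R) (i : I) (x : R) : cvgn (pseries (term v i) x).
Proof.
apply: normed_cvg; rewrite /normed_series_of /=.
apply: (@series_le_cvg _ _
  (fun k => (\sum_j `|v j|) * exp_coeff (rate * `|x|) k)) => [k|k|k|].
- exact: normr_ge0.
- by apply: mulr_ge0; [exact: sumr_ge0 | apply/exp_coeff_ge0/mulr_ge0].
- rewrite /term /exp_coeff /= normrM normf_div normrX exprMn.
  rewrite [`|k`!%:R|]ger0_norm // mulrAC [leRHS]mulrA.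
  rewrite ler_wpM2r ?invr_ge0 // mulrA ler_wpM2r ?exprn_ge0 //.
  by rewrite [leRHS]mulrC iter_act_le.
- by apply: is_cvg_seriesZ; exact: is_cvg_series_exp_coeff.
Qed.

Lemma real_linear_ode_exists (x0 : I -> R) :
  exists x : I -> R -> R, (forall i, x i 0 = x0 i) /\
    forall t i, is_derive t (1 : R) (x i) (\sum_j A i j * x j t).
Proof.
exists (fun i t => limn (pseries (term x0 i) t)); split=> [i|t i].
  (* At time 0 only the term of index 0 survives, so every nonempty partial sum equals [x0 i]. *)
  apply: lim_near_cst => //; near=> n.
  rewrite -[n]prednK; last by near: n.
  rewrite /pseries seriesEnat /= big_nat_recl //= big1 => [|k _].
    by rewrite expr0 mulr1 addr0 /term /= fact0 divr1.
  by rewrite exprS mul0r mulr0.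
have -> : \sum_j A i j * limn (pseries (term x0 j) t) =
          limn (pseries (pseries_diffs (term x0 i)) t).
  apply/esym/cvg_lim => //; rewrite term_diffs.
  have -> : pseries (term (act x0) i) t =
            (fun n => \sum_j A i j * pseries (term x0 j) t n).
    apply/funext => n; rewrite /pseries !seriesEnat /=.
    under [RHS]eq_bigr do rewrite seriesEnat /= mulr_sumr.
    rewrite exchange_big; apply: eq_bigr => k _.
    rewrite /term -iterSr iterS /act mulr_suml mulr_suml.
    by apply: eq_bigr => j _; rewrite !mulrA.
  apply: cvg_big => [|j _]; first exact: add_continuous.
  by apply: cvgMl_tmp; exact: cvg_term.
(* Termwise differentiation at [t] needs convergence at a point of larger modulus; [|t| + 1]
   serves. *)
apply: (@pseries_snd_diffs _ _ (`|t| + 1)); rewrite ?term_diffs //.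
by rewrite [ltRHS]ger0_norm // ltrDl.
Unshelve. all: by end_near. Qed.

(* Gronwall: the squared length is at most [exp (2 * rate * t)] times its
   initial value. *)
Lemma real_linear_ode_zero (x : I -> R -> R) :
  (forall t : R, 0 <= t ->
    forall i, is_derive t (1 : R) (x i) (\sum_j A i j * x j t)) ->
  (forall i, x i 0 = 0) -> forall t : R, 0 <= t -> forall i, x i t = 0.
Proof.
move=> dx x0 t t_ge0.
pose g s := \sum_i x i s * x i s.
pose dg s := \sum_i 2 * (x i s * \sum_j A i j * x j s).
have xg s i : x i s ^+ 2 <= g s.
  rewrite /g (bigD1 i) //= expr2 lerDl.
  by apply: sumr_ge0 => j _; rewrite -expr2 sqr_ge0.
have g_deriv (s : R) : 0 <= s -> is_derive s (1 : R) g (dg s).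
  move=> s_ge0; apply: is_derive_bigsum => i.
  have := is_deriveM (dx s s_ge0 i) (dx s s_ge0 i).
  by move/is_derive_eq; apply; rewrite -mulr2n mulr_natl.
have dg_le s : dg s <= (2 * rate) * g s.
  move: (g s) (xg s) => G xG.
  rewrite /dg /rate mulr_sumr mulr_suml; apply: ler_sum => i _.
  rewrite -mulrA ler_wpM2l // mulr_sumr mulr_suml; apply: ler_sum => j _.
  rewrite mulrCA (le_trans (ler_norm _)) // normrM ler_wpM2l // normrM.
  (* The estimate is [|x_i| |x_j| <= (x_i^2 + x_j^2) / 2 <= g]. *)
  have := xG i; have := xG j; have := sqr_ge0 (`|x i s| - `|x j s|).
  rewrite -(real_normK (num_real (x i s))) -(real_normK (num_real (x j s))).
  by nra.
pose h s := g s * expR (- (2 * rate) * s).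
pose dh s := g s * (expR (- (2 * rate) * s) * - (2 * rate)) +
             expR (- (2 * rate) * s) * dg s.
have h_deriv (s : R) : 0 <= s -> is_derive s (1 : R) h (dh s).
  move=> s_ge0; apply: is_deriveM (g_deriv s s_ge0) _.
  apply: is_derive1_comp.
  have := is_deriveZ (- (2 * rate)) (is_derive_id s (1 : R)).
  by move/is_derive_eq; apply; rewrite scaler1.
have h_le : h t <= h 0.
  apply: (nincr_of_deriv_le0 h_deriv) => // s s_ge0.
  have -> : dh s = expR (- (2 * rate) * s) * (dg s - 2 * rate * g s).
    by rewrite /dh; ring.
  by rewrite mulr_ge0_le0 ?expR_ge0 // subr_le0.
move=> i; apply/eqP; rewrite -sqrf_eq0 eq_le sqr_ge0 andbT.
apply: le_trans (xg t i) _.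
rewrite -(pmulr_lle0 _ (expR_gt0 (- (2 * rate) * t))).
apply: le_trans h_le _.
by rewrite /h /g big1 ?mul0r // => j _; rewrite x0 mul0r.
Qed.

End RealLinearODE.

(** * Derivatives of complex-valued functions of a real variable *)

Section ComplexDerivative.
Variable R : realType.
Implicit Types (f g : R -> R[i]) (t : R) (a y z : R[i]).

Lemma has_deriv_cst a t : has_deriv (fun=> a) t 0.
Proof. by split; exact: is_derive_cst. Qed.

Lemma has_derivD f g t y z :
  has_deriv f t y -> has_deriv g t z ->
  has_deriv (fun s => f s + g s) t (y + z).
Proof.
move=> [fR fI] [gR gI]; split; rewrite raddfD;
  by under eq_fun do rewrite raddfD; exact: is_deriveD.
Qed.

Lemma has_derivM f g t y z :
  has_deriv f t y -> has_deriv g t z ->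
  has_deriv (fun s => f s * g s) t (y * g t + f t * z).
Proof.
have ReM a b : complex.Re (a * b : R[i]) =
    complex.Re a * complex.Re b - complex.Im a * complex.Im b.
  by case: a b => [? ?] [? ?].
have ImM a b : complex.Im (a * b : R[i]) =
    complex.Re a * complex.Im b + complex.Im a * complex.Re b.
  by case: a b => [? ?] [? ?].
move=> [fR fI] [gR gI]; split; rewrite raddfD /=.
  under eq_fun do rewrite ReM.
  have := is_deriveB (is_deriveM fR gR) (is_deriveM fI gI).
  by move/is_derive_eq; apply; rewrite !ReM /GRing.scale /=; ring.
under eq_fun do rewrite ImM.
have := is_deriveD (is_deriveM fR gI) (is_deriveM fI gR).
by move/is_derive_eq; apply; rewrite !ImM /GRing.scale /=; ring.
Qed.

Lemma has_derivZ a f t z :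
  has_deriv f t z -> has_deriv (fun s => a * f s) t (a * z).
Proof.
by move=> /(has_derivM (has_deriv_cst a t)); rewrite mul0r add0r.
Qed.

Lemma has_deriv_sum (I : Type) (r : seq I) (f : I -> R -> R[i])
    (df : I -> R[i]) t :
  (forall i, has_deriv (f i) t (df i)) ->
  has_deriv (fun s => \sum_(i <- r) f i s) t (\sum_(i <- r) df i).
Proof.
move=> fdf; split; rewrite raddf_sum; under eq_fun do rewrite raddf_sum;
  by apply: is_derive_bigsum => i; have [] := fdf i.
Qed.

Lemma has_deriv_conj f t z :
  has_deriv f t z -> has_deriv (fun s => Num.conj (f s)) t (Num.conj z).
Proof.
have ReJ a : complex.Re (Num.conj a) = complex.Re a by case: a.
have ImJ a : complex.Im (Num.conj a) = - complex.Im a by case: a.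
move=> [fR fI]; split; first by rewrite ReJ; under eq_fun do rewrite ReJ.
by rewrite ImJ; under eq_fun do rewrite ImJ; exact: is_deriveN.
Qed.

Lemma has_deriv_unique f t y z : has_deriv f t y -> has_deriv f t z -> y = z.
Proof.
move=> [fyR fyI] [fzR fzI]; apply/eqP; rewrite eq_complex.
by rewrite -(@derive_val _ _ _ _ _ _ _ fyR) -(@derive_val _ _ _ _ _ _ _ fyI)
  !derive_val !eqxx.
Qed.

(** A two-sided derivative is also the limit of the right difference quotients, all zero here. This
    form is needed because evolutions are only controlled at nonnegative times. *)
Lemma is_derive0_eq0_right (f : R -> R) (df : R) :
  is_derive (0 : R) (1 : R) f df -> (forall t : R, 0 <= t -> f t = 0) -> df = 0.
Proof.
move=> [fdf <-] f0.
have := cvg_dnbhs_at_right fdf; rewrite -/(derive f 0 1) => Df.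
apply: (cvg_unique _ Df) => //.
apply: cvg_near_cst; near=> h.
by rewrite /= !f0 // ?subrr ?scaler0 // addr0 /GRing.scale /= mulr1.
Unshelve. all: by end_near. Qed.

Lemma has_deriv0_eq0_right f z :
  has_deriv f 0 z -> (forall t : R, 0 <= t -> f t = 0) -> z = 0.
Proof.
move=> [fR fI] f0; apply/eqP; rewrite eq_complex.
rewrite (is_derive0_eq0_right fR) => [|t t_ge0]; last by rewrite f0.
by rewrite (is_derive0_eq0_right fI) ?eqxx // => t t_ge0; rewrite f0.
Qed.

End ComplexDerivative.

(** * Matrix-valued functions and complex linear systems *)

Definition mx_has_deriv (R : realType) (m n : nat) (X : R -> 'M[R[i]]_(m, n))
    (t : R) (Y : 'M[R[i]]_(m, n)) : Prop :=
  forall i j, has_deriv (fun s => X s i j) t (Y i j).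

Section MatrixDerivative.
Variable R : realType.

(** Each entry of the image is a fixed combination of the entries of [X], which reduces
    differentiation through [f] to finite sums and scalings. *)
Lemma linear_mx_entry (m n p q : nat)
    (f : {linear 'M[R[i]]_(m, n) -> 'M[R[i]]_(p, q)}) (X : 'M[R[i]]_(m, n))
    i j :
  f X i j = \sum_k \sum_l X k l * f (delta_mx k l) i j.
Proof.
rewrite {1}[X]matrix_sum_delta linear_sum summxE; apply: eq_bigr => k _.
rewrite linear_sum summxE; apply: eq_bigr => l _.
by rewrite linearZ mxE.
Qed.

Lemma mx_has_deriv_linear (m n p q : nat)
    (f : {linear 'M[R[i]]_(m, n) -> 'M[R[i]]_(p, q)}) X t Y :
  mx_has_deriv X t Y -> mx_has_deriv (fun s => f (X s)) t (f Y).
Proof.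
move=> dX i j; rewrite linear_mx_entry.
under eq_fun do rewrite linear_mx_entry.
apply: has_deriv_sum => k; apply: has_deriv_sum => l.
by under eq_fun do rewrite mulrC; rewrite mulrC; exact: has_derivZ.
Qed.

Lemma mx_has_derivB (m n : nat) (X Y : R -> 'M[R[i]]_(m, n)) t X' Y' :
  mx_has_deriv X t X' -> mx_has_deriv Y t Y' ->
  mx_has_deriv (fun s => X s - Y s) t (X' - Y').
Proof.
move=> dX dY i j; rewrite !mxE -mulN1r.
under eq_fun do rewrite !mxE -mulN1r.
exact: has_derivD (dX i j) (has_derivZ _ (dY i j)).
Qed.

Lemma mx_has_deriv_mul (m n p : nat) (X : R -> 'M[R[i]]_(m, n))
    (Y : R -> 'M[R[i]]_(n, p)) t X' Y' :
  mx_has_deriv X t X' -> mx_has_deriv Y t Y' ->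
  mx_has_deriv (fun s => X s *m Y s) t (X' *m Y t + X t *m Y').
Proof.
move=> dX dY i j; rewrite !mxE -big_split /=.
under eq_fun do rewrite !mxE.
by apply: has_deriv_sum => k; exact: has_derivM.
Qed.

Lemma mx_has_deriv_adj (m n : nat) (X : R -> 'M[R[i]]_(m, n)) t X' :
  mx_has_deriv X t X' -> mx_has_deriv (fun s => (X s) ^t*) t (X' ^t*).
Proof.
move=> dX i j; rewrite !mxE; under eq_fun do rewrite !mxE.
exact: has_deriv_conj.
Qed.

Lemma has_deriv_mxtrace (n : nat) (X : R -> 'M[R[i]]_n) t X' :
  mx_has_deriv X t X' -> has_deriv (fun s => \tr (X s)) t (\tr X').
Proof. by move=> dX; exact: has_deriv_sum. Qed.

Variables (m n : nat) (f : {linear 'M[R[i]]_(m, n) -> 'M[R[i]]_(m, n)}).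

(* The real coordinates of a complex matrix are indexed by its entries together
   with a boolean that is true for imaginary parts. *)
Let coord (X : 'M[R[i]]_(m, n)) (p : 'I_m * 'I_n * bool) : R :=
  (if p.2 then @complex.Im R else @complex.Re R) (X p.1.1 p.1.2).

(** The real basis dual to [coord]. *)
Let unit_mx (p : 'I_m * 'I_n * bool) : 'M[R[i]]_(m, n) :=
  (if p.2 then 'i%C else 1) *: delta_mx p.1.1 p.1.2.

Let real_mx (p q : 'I_m * 'I_n * bool) : R := coord (f (unit_mx q)) p.

Let coord_linear (X : 'M[R[i]]_(m, n)) p :
  coord (f X) p = \sum_q real_mx p q * coord X q.
Proof.
have X_units : X = \sum_q (coord X q)%:C *: unit_mx q.
  rewrite [LHS]matrix_sum_delta pair_bigA /=.
  rewrite -(pair_bigA _ (fun kl b => (coord X (kl, b))%:C *: unit_mx (kl, b))).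
  apply: eq_bigr => -[k l] _ /=.
  rewrite big_bool /= !scalerA -scalerDl; congr (_ *: _).
  by rewrite /coord /= mulr1 addrC [LHS]complexE mulrC.
have coordE Y c : coord ((c : R)%:C *: Y) p = c * coord Y p.
  by rewrite /coord mxE; case: p.2; case: (Y _ _) => ? ? /=; ring.
have coord_sum (Y : _ -> 'M[R[i]]_(m, n)) :
    coord (\sum_(q : 'I_m * 'I_n * bool) Y q) p = \sum_q coord (Y q) p.
  by rewrite /coord summxE; case: p.2; rewrite raddf_sum.
rewrite {1}X_units linear_sum coord_sum; apply: eq_bigr => q _.
by rewrite linearZ coordE mulrC.
Qed.

(** Real and imaginary parts of the entries solve a real linear system with matrix [real_mx]. *)
Lemma mx_linear_ode_exists (X0 : 'M[R[i]]_(m, n)) :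
  exists X : R -> 'M[R[i]]_(m, n),
    X 0 = X0 /\ forall t, mx_has_deriv X t (f (X t)).
Proof.
have [x [x0 dx]] := real_linear_ode_exists real_mx (coord X0).
pose X t := \matrix_(i, j) (x (i, j, false) t +i* x (i, j, true) t).
have coordX t p : coord (X t) p = x p t.
  by case: p => -[i j] []; rewrite /coord mxE.
exists X; split=> [|t i j].
  by apply/matrixP => i j; rewrite mxE !x0 /coord /=; case: (X0 i j).
have dX p : is_derive t (1 : R) (x p) (coord (f (X t)) p).
  by rewrite coord_linear; under eq_bigr do rewrite coordX; exact: dx.
by split; [under eq_fun do rewrite mxE; exact: (dX (i, j, false))
          |under eq_fun do rewrite mxE; exact: (dX (i, j, true))].
Qed.

(** The difference of two solutions solves the same system from zero, and the real uniqueness result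
    applies to its coordinates. *)
Lemma mx_linear_ode_unique (X Y : R -> 'M[R[i]]_(m, n)) :
  (forall t : R, 0 <= t -> mx_has_deriv X t (f (X t))) ->
  (forall t : R, 0 <= t -> mx_has_deriv Y t (f (Y t))) ->
  X 0 = Y 0 -> forall t : R, 0 <= t -> X t = Y t.
Proof.
move=> dX dY XY0 t t_ge0; pose Z s := X s - Y s.
have dZ (s : R) : 0 <= s -> mx_has_deriv Z s (f (Z s)).
  by move=> s_ge0; rewrite raddfB; apply: mx_has_derivB; [exact: dX|exact: dY].
have Z_coord0 := @real_linear_ode_zero _ _ real_mx (fun p s => coord (Z s) p).
have {}Z_coord0 p : coord (Z t) p = 0.
  apply: Z_coord0 t_ge0 p => [s s_ge0 q|q].
    rewrite -coord_linear /coord.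
    by have [] := dZ s s_ge0 q.1.1 q.1.2; case: q.2.
  by rewrite /coord /Z XY0 subrr mxE; case: q.2.
apply/subr0_eq/matrixP => i j; rewrite [RHS]mxE -/(Z t).
have := Z_coord0 (i, j, false); have := Z_coord0 (i, j, true).
by rewrite /coord /=; case: (Z t i j) => a b /= -> ->.
Qed.

End MatrixDerivative.

(** * The master equation on pure states *)

Section Adjoint.
Variable C : numClosedFieldType.

Lemma adjmxM (m n p : nat) (X : 'M[C]_(m, n)) (Y : 'M[C]_(n, p)) :
  (X *m Y) ^t* = Y ^t* *m X ^t*.
Proof. by rewrite trmx_mul map_mxM. Qed.

Lemma adjmxK (m n : nat) (X : 'M[C]_(m, n)) : (X ^t*) ^t* = X.
Proof. by apply/matrixP => i j; rewrite !mxE conjCK. Qed.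

Lemma adjmxD (m n : nat) (X Y : 'M[C]_(m, n)) : (X + Y) ^t* = X ^t* + Y ^t*.
Proof. by rewrite linearD raddfD. Qed.

Lemma adjmxB (m n : nat) (X Y : 'M[C]_(m, n)) : (X - Y) ^t* = X ^t* - Y ^t*.
Proof. by rewrite linearB raddfB. Qed.

Lemma adjmxZ (m n : nat) (a : C) (X : 'M[C]_(m, n)) :
  (a *: X) ^t* = Num.conj a *: X ^t*.
Proof. by rewrite linearZ map_mxZ. Qed.

Lemma adjmx_sum (m n : nat) (I : Type) (r : seq I) (P : pred I)
    (X : I -> 'M[C]_(m, n)) :
  (\sum_(i <- r | P i) X i) ^t* = \sum_(i <- r | P i) (X i) ^t*.
Proof. by rewrite linear_sum raddf_sum. Qed.

Lemma adjmx_mul_ge0 (n : nat) (v : 'cV[C]_n) : 0 <= (v ^t* *m v) 0 0.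
Proof.
by rewrite mxE; apply: sumr_ge0 => i _; rewrite !mxE mulrC mul_conjC_ge0.
Qed.

Lemma adjmx_mul_eq0 (n : nat) (v : 'cV[C]_n) :
  ((v ^t* *m v) 0 0 == 0) = (v == 0).
Proof.
apply/eqP/eqP => [|->]; last by rewrite mulmx0 mxE.
rewrite mxE => /psumr_eq0P v0; apply/matrixP => i j.
rewrite (ord1 j) mxE; apply/eqP; rewrite -mul_conjC_eq0 mulrC.
have := v0 (fun k _ => _) i isT; rewrite !mxE => -> // k.
by rewrite !mxE mulrC mul_conjC_ge0.
Qed.

(** Reduces claims about vectors of [E] to unit vectors, the ones that define pure states. *)
Lemma unit_multiple (n : nat) (E : {vspace 'cV[C]_n}) (v : 'cV[C]_n) :
  v \in E -> v != 0 -> exists (a : C) (u : 'cV[C]_n),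
    [/\ u \in E, u ^t* *m u = 1%:M & v = a *: u].
Proof.
move=> v_in v_neq0; set s := (v ^t* *m v) 0 0.
have s_neq0 : s != 0 by rewrite adjmx_mul_eq0.
have r_ge0 : 0 <= sqrtC s by rewrite sqrtC_ge0 adjmx_mul_ge0.
exists (sqrtC s), ((sqrtC s)^-1 *: v); split; first exact: memvZ.
  rewrite adjmxZ -scalemxAl -scalemxAr scalerA geC0_conj ?invr_ge0 //.
  rewrite [v ^t* *m v]mx11_scalar -/s scale_scalar_mx; congr (_%:M).
  by rewrite -invfM -expr2 sqrtCK mulVf.
by rewrite scalerA mulfV ?scale1r // sqrtC_eq0.
Qed.

Lemma mulmx_cV11 (n : nat) (w : 'cV[C]_n) (P : 'M[C]_1) :
  w *m P = P 0 0 *: w.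
Proof. by rewrite {1}[P]mx11_scalar mul_mx_scalar. Qed.

Lemma eigenvectorZ (n : nat) (A : 'M[C]_n) (a b : C) (u : 'cV[C]_n) :
  A *m u = b *: u -> A *m (a *: u) = b *: (a *: u).
Proof. by move=> Au; rewrite -scalemxAr Au !scalerA mulrC. Qed.

(** For a unit vector, [-i [H, u u^+] u] equals [-i (H u - <u|H u> u)]. Multiplying by [i] and
    adding back the multiple of [u] recovers [H u]. *)
Lemma commutator_outer_mem (n : nat) (E : {vspace 'cV[C]_n}) (H : 'M[C]_n)
    (u : 'cV[C]_n) : u \in E -> u ^t* *m u = 1%:M ->
  (- 'i *: (H *m (u *m u ^t*) - u *m u ^t* *m H)) *m u \in E -> H *m u \in E.
Proof.
move=> u_in u1.
have -> : (- 'i *: (H *m (u *m u ^t*) - u *m u ^t* *m H)) *m u =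
    - 'i *: (H *m u - u *m (u ^t* *m (H *m u))).
  by rewrite -scalemxAl mulmxBl -!mulmxA u1 mulmx1.
rewrite mulmx_cV11; move: ((u ^t* *m (H *m u)) 0 0) => b /(memvZ 'i).
rewrite scalerA mulrN -expr2 sqrCi opprK scale1r => Hu.
by have := memvD Hu (memvZ b u_in); rewrite subrK.
Qed.

Lemma schroedinger_norm_rate (n : nat) (H : 'M[C]_n) (u : 'cV[C]_n) :
  H ^t* = H ->
  (- 'i *: (H *m u)) ^t* *m u + u ^t* *m (- 'i *: (H *m u)) = 0.
Proof.
move=> H_adj; rewrite adjmxZ adjmxM H_adj rmorphN /= conjCi opprK.
by rewrite -scalemxAl -scalemxAr mulmxA -scalerDl subrr scale0r.
Qed.

(** The product rule for [u u^+] along [u' = -i H u] yields the commutator form of the evolution. *)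
Lemma schroedinger_outer_rate (n : nat) (H : 'M[C]_n) (u : 'cV[C]_n) :
  H ^t* = H ->
  - 'i *: (H *m u) *m u ^t* + u *m (- 'i *: (H *m u)) ^t* =
  - 'i *: (H *m (u *m u ^t*) - u *m u ^t* *m H).
Proof.
move=> H_adj; rewrite adjmxZ adjmxM H_adj rmorphN /= conjCi opprK.
by rewrite -scalemxAl -scalemxAr !mulmxA scalerBr !scaleNr opprK.
Qed.

(** Cyclicity of the trace gives [tr(H rho rho) = tr(rho H rho)], so commutator evolution preserves
    purity. *)
Lemma commutator_purity_rate (n : nat) (H rho : 'M[C]_n) (a : C) :
  \tr (a *: (H *m rho - rho *m H) *m rho + rho *m (a *: (H *m rho - rho *m H)))
  = 0.
Proof.
rewrite linearD /= [\tr (rho *m _)]mxtrace_mulC -scalemxAl linearZ /=.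
rewrite mulmxBl linearB /= -[rho *m H *m rho]mulmxA.
by rewrite [\tr (rho *m _)]mxtrace_mulC subrr mulr0 addr0.
Qed.

Lemma conj_i_half : Num.conj ('i / 2 : C) = - ('i / 2).
Proof. by rewrite rmorphM /= conjCi fmorphV /= conjC_nat mulNr. Qed.

Lemma opp_i_mul_i_half : - 'i * ('i / 2) = 2^-1 :> C.
Proof. by rewrite mulrA mulNr -expr2 sqrCi opprK mul1r. Qed.

Lemma half_mulr2n_mx (m n : nat) (X : 'M[C]_(m, n)) i j :
  2^-1 * (- X *+ 2) i j = - X i j.
Proof. by rewrite mulr2n !mxE mulrC mulrDl -splitr. Qed.

Lemma adjmx_comm11 (P : 'M[C]_1) : P ^t* *m P = P *m P ^t*.
Proof. by rewrite [P]mx11_scalar; exact: scalar_mxC. Qed.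

Variables (N : nat) (J : 'M[C]_N) (v : 'cV[C]_N).
Let rho := v *m v ^t*.
(** One jump term of the dissipator on a pure state, expanded, without its weight and the factor
    [1/2]. *)
Let jump_action :=
  (J *m rho *m J ^t*) *+ 2 - rho *m J ^t* *m J - J ^t* *m J *m rho.

(** Both sides expand to [2 |c|^2 rho - c^* rho J - c J^+ rho]. *)
Lemma jump_action_eigen (c : C) : J *m v = c *: v ->
  jump_action = (Num.conj c *: J - c *: J ^t*) *m rho -
                rho *m (Num.conj c *: J - c *: J ^t*).
Proof.
move=> Jv; have vJ : v ^t* *m J ^t* = Num.conj c *: v ^t*.
  by rewrite -adjmxM Jv adjmxZ.
have Jrho : J *m rho = c *: rho by rewrite mulmxA Jv scalemxAl.
have rhoJ : rho *m J ^t* = Num.conj c *: rho.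
  by rewrite -mulmxA vJ scalemxAr.
rewrite /jump_action mulmxBl mulmxBr -!scalemxAl -!scalemxAr.
rewrite -[J ^t* *m J *m _]mulmxA Jrho rhoJ -!scalemxAl -!scalemxAr rhoJ.
rewrite !scalerA [c * _]mulrC mulr2n opprB.
set a := _ *: rho; set b := _ *: (rho *m J); set d := _ *: (J ^t* *m rho).
by rewrite [RHS]addrACA -[LHS]addrA [- b - d]addrC.
Qed.

(** Here [w] is the part of [J v] orthogonal to [v]. The expectation is [2 |<v|J v>|^2 - 2 |J v|^2],
    which is [-2 |w|^2] by Pythagoras. *)
Lemma jump_action_expect : v ^t* *m v = 1%:M ->
  let w := J *m v - v *m (v ^t* *m (J *m v)) in
  v ^t* *m jump_action *m v = - (w ^t* *m w) *+ 2.
Proof.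
move=> v1 /=.
have vK n (X : 'M[C]_(1, n)) : v ^t* *m (v *m X) = X.
  by rewrite mulmxA v1 mul1mx.
set w := J *m v; set P := v ^t* *m w.
have PC := adjmx_comm11 P.
have -> : v ^t* *m jump_action *m v = (P ^t* *m P - w ^t* *m w) *+ 2.
  rewrite /jump_action /rho mulr2n !mulmxBr !mulmxBl mulmxDr mulmxDl.
  rewrite PC /P /w !adjmxM adjmxK -!mulmxA v1 mulmx1 !vK.
  by rewrite -mulr2n mulrnBl [in RHS]mulr2n opprD addrA.
congr (_ *+ _).
rewrite adjmxB mulmxBl !mulmxBr (adjmxM v P) -!mulmxA vK.
have -> : w ^t* *m (v *m P) = P ^t* *m P by rewrite mulmxA /P adjmxM adjmxK.
by rewrite -/P subrr subr0 opprB.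
Qed.

End Adjoint.

(* Two eigenvectors with different eigenvalues cannot have a sum that is an
   eigenvector, unless one of them vanishes. *)
Lemma common_eigenvalue (F : fieldType) (n : nat) (A : 'M[F]_n)
    (E : {vspace 'cV[F]_n}) :
  (forall v : 'cV[F]_n, v \in E -> exists a, A *m v = a *: v) ->
  exists a, forall v : 'cV[F]_n, v \in E -> A *m v = a *: v.
Proof.
move=> eig; have [-> | E_neq0] := eqVneq E 0%VS.
  by exists 0 => v; rewrite memv0 => /eqP ->; rewrite mulmx0 scaler0.
have [w w_in w_neq0] : exists2 w : 'cV[F]_n, w \in E & w != 0.
  by exists (vpick E); rewrite ?memv_pick ?vpick0.
have [a Aw] := eig w w_in; exists a => v v_in.
have [b Av] := eig v v_in; have [d Awv] := eig (w + v) (memvD w_in v_in).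
have wv : (a - d) *: w + (b - d) *: v = 0.
  by rewrite !scalerBl addrACA -opprD -scalerDr -Awv mulmxDr Aw Av subrr.
have [bd | b_neq_d] := eqVneq b d.
  move: wv; rewrite bd subrr scale0r addr0 => /eqP.
  by rewrite Av bd scaler_eq0 (negPf w_neq0) orbF subr_eq0 => /eqP ->.
(* When [b] and [d] differ, the relation makes [v] a multiple of [w], hence an eigenvector for [a]
   as well. *)
have -> : v = ((d - a) / (b - d)) *: w.
  apply: (@scalerI _ _ (b - d)); first by rewrite subr_eq0.
  rewrite scalerA mulrCA mulfV ?subr_eq0 // mulr1 -(opprB a d) scaleNr.
  by apply/eqP; rewrite -addr_eq0 addrC wv.
by rewrite -scalemxAr Aw !scalerA mulrC.
Qed.

(** * Linearity of the master equation and its values on pure states *)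

Section MasterEquation.
Variables (R : realType) (N m M : nat) (Heff : 'M[R[i]]_N).
Variables (lam : 'I_m -> R) (J : 'I_m -> 'M[R[i]]_N).

Lemma mxcomm_linearl (X Y Z : 'M[R[i]]_N) a :
  mxcomm (a *: X + Y) Z = a *: mxcomm X Z + mxcomm Y Z.
Proof.
by rewrite /mxcomm mulmxDl mulmxDr -scalemxAl -scalemxAr scalerBr opprD addrACA.
Qed.

Lemma mxcommZl (X Y : 'M[R[i]]_N) a : mxcomm (a *: X) Y = a *: mxcomm X Y.
Proof. by rewrite /mxcomm -scalemxAl -scalemxAr scalerBr. Qed.

Lemma mxcomm_linearr (X Y Z : 'M[R[i]]_N) a :
  mxcomm Z (a *: X + Y) = a *: mxcomm Z X + mxcomm Z Y.
Proof.
by rewrite /mxcomm mulmxDl mulmxDr -scalemxAl -scalemxAr scalerBr opprD addrACA.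
Qed.

Let jump_diss (l : 'I_m) (X : 'M[R[i]]_N) :=
  mxcomm (J l) (X *m (J l) ^t*) + mxcomm (J l *m X) ((J l) ^t*).

Let jump_dissE l X : jump_diss l X =
  (J l *m X *m (J l) ^t*) *+ 2 - X *m (J l) ^t* *m J l - (J l) ^t* *m J l *m X.
Proof.
rewrite /jump_diss /mxcomm !mulmxA mulr2n.
by rewrite addrACA -opprD -[in RHS]addrA -opprD.
Qed.

Let jump_diss_linear l a X Y :
  jump_diss l (a *: X + Y) = a *: jump_diss l X + jump_diss l Y.
Proof.
rewrite /jump_diss mulmxDl mulmxDr -scalemxAl -scalemxAr.
by rewrite mxcomm_linearr mxcomm_linearl addrACA -scalerDr.
Qed.

Let dissipatorE X : dissipator M lam J X =
  2^-1 *: \sum_(l < m | (l < M)%N) (lam l)%:C *: jump_diss l X.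
Proof. by []. Qed.

Let dissipator_linear a X Y : dissipator M lam J (a *: X + Y) =
  a *: dissipator M lam J X + dissipator M lam J Y.
Proof.
rewrite !dissipatorE scalerA [a * _]mulrC -scalerA -scalerDr; congr (_ *: _).
rewrite scaler_sumr -big_split; apply: eq_bigr => l _ /=.
by rewrite jump_diss_linear scalerDr !scalerA mulrC.
Qed.

Lemma master_rhs_linear : linear (master_rhs M Heff lam J).
Proof.
move=> a X Y; rewrite /master_rhs mxcomm_linearr dissipator_linear.
by rewrite !scalerDr !scalerA mulrC addrACA.
Qed.

(** Lets the existence and uniqueness results for linear systems apply to the master equation. *)
HB.instance Definition _ := GRing.isLinear.Build R[i] 'M[R[i]]_N 'M[R[i]]_N
  *:%R (master_rhs M Heff lam J) master_rhs_linear.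

(** Each [c^* J - c J^+] is anti-Hermitian, the weights are real, and the factor [i/2] turns the sum
    Hermitian. *)
Lemma H_ev_adj (c : 'I_m -> R[i]) :
  Heff \is hermsymmx -> (H_ev M Heff lam J c) ^t* = H_ev M Heff lam J c.
Proof.
move=> /is_hermitianmxP; rewrite expr0 scale1r => Heff_adj.
rewrite /H_ev adjmxD -Heff_adj; congr (_ + _).
rewrite adjmxZ conj_i_half scaleNr -scalerN; congr (_ *: _).
rewrite adjmx_sum -sumrN; apply: eq_bigr => l _.
have lam_conj : Num.conj (lam l)%:C = (lam l)%:C by exact: conjc_real.
by rewrite adjmxZ lam_conj adjmxB !adjmxZ adjmxK conjCK -scalerN opprB.
Qed.

(** Every jump term becomes a commutator, and [-i * (i/2) = 1/2] matches the prefactor of the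
    dissipator. *)
Lemma master_rhs_eigen (c : 'I_m -> R[i]) (v : 'cV[R[i]]_N) :
  (forall l : 'I_m, (l < M)%N -> J l *m v = c l *: v) ->
  master_rhs M Heff lam J (v *m v ^t*) =
  - 'i *: mxcomm (H_ev M Heff lam J c) (v *m v ^t*).
Proof.
move=> Jv; set rho := v *m v ^t*; set S := \sum_(l < m | (l < M)%N)
  (lam l)%:C *: (Num.conj (c l) *: J l - c l *: (J l) ^t*).
have -> : mxcomm (H_ev M Heff lam J c) rho =
    mxcomm Heff rho + ('i / 2) *: mxcomm S rho.
  by rewrite /H_ev addrC mxcomm_linearl addrC.
rewrite [RHS]scalerDr /master_rhs dissipatorE; congr (_ + _).
have mxcomm_sum (X : 'I_m -> 'M[R[i]]_N) Y :
    mxcomm (\sum_(l < m | (l < M)%N) X l) Y =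
    \sum_(l < m | (l < M)%N) mxcomm (X l) Y.
  by rewrite /mxcomm mulmx_suml mulmx_sumr -sumrB.
rewrite mxcomm_sum scalerA opp_i_mul_i_half.
congr (_ *: _); apply: eq_bigr => l lM.
rewrite mxcommZl; congr (_ *: _).
by rewrite jump_dissE; exact: jump_action_eigen (Jv l lM).
Qed.

Lemma mxtrace_outer (X : 'M[R[i]]_N) (v : 'cV[R[i]]_N) :
  \tr (v *m v ^t* *m X) = (v ^t* *m X *m v) 0 0.
Proof. by rewrite -mulmxA mxtrace_mulC /mxtrace big_ord1. Qed.

(** This is half the derivative of the purity. The Hamiltonian part drops out because a commutator
    with [v v^+] has zero expectation in [v]. *)
Lemma purity_rate (v : 'cV[R[i]]_N) : v ^t* *m v = 1%:M ->
  \tr (v *m v ^t* *m master_rhs M Heff lam J (v *m v ^t*)) =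
  - \sum_(l < m | (l < M)%N) (lam l)%:C *
    let w := J l *m v - v *m (v ^t* *m (J l *m v)) in (w ^t* *m w) 0 0.
Proof.
move=> v1; rewrite mxtrace_outer /master_rhs.
have vK n (X : 'M[R[i]]_(1, n)) : v ^t* *m (v *m X) = X.
  by rewrite mulmxA v1 mul1mx.
have -> : v ^t* *m (- 'i *: mxcomm Heff (v *m v ^t*) +
    dissipator M lam J (v *m v ^t*)) *m v =
    v ^t* *m dissipator M lam J (v *m v ^t*) *m v.
  rewrite mulmxDr mulmxDl -scalemxAr -scalemxAl /mxcomm mulmxBr mulmxBl.
  by rewrite -!mulmxA v1 !mulmx1 vK subrr scaler0 add0r.
rewrite /dissipator -scalemxAr -scalemxAl mulmx_sumr mulmx_suml mxE summxE.
rewrite mulr_sumr -sumrN; apply: eq_bigr => l _.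
rewrite -scalemxAr -scalemxAl mxE mulrCA -mulrN; congr (_ * _).
by rewrite -/(jump_diss l _) jump_dissE jump_action_expect // half_mulr2n_mx.
Qed.

End MasterEquation.

(** * Decoherence-free subspaces *)

(** The complementary projection turns membership in [E] into a linear equation, which can be
    differentiated. *)
Lemma vspace_annihilator (F : fieldType) (n : nat) (E : {vspace 'cV[F]_n}) :
  exists Q : {linear 'cV[F]_n -> 'cV[F]_n},
    forall w : 'cV[F]_n, Q w = 0 <-> w \in E.
Proof.
exists (\1 - projv E)%VF => w.
have QE : (\1 - projv E)%VF w = w - projv E w by rewrite !lfun_simp.
split=> [Qw0|w_in]; last by apply: (etrans QE); rewrite projv_id // subrr.
by rewrite (subr0_eq (etrans (esym QE) Qw0)) memv_proj.
Qed.

Section DecoherenceFree.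
Variables (R : realType) (N m M : nat) (Heff : 'M[R[i]]_N).
Variables (lam : 'I_m -> R) (J : 'I_m -> 'M[R[i]]_N).
Hypothesis Heff_herm : Heff \is hermsymmx.
Hypothesis lam_gt0 : forall l : 'I_m, (l < M)%N -> 0 < lam l.

Lemma master_solution_exists (X : 'M[R[i]]_N) :
  exists2 rho, master_solution M Heff lam J rho & rho 0 = X.
Proof.
have [rho [rho0 drho]] := mx_linear_ode_exists (master_rhs M Heff lam J) X.
by exists rho => // t _; exact: drho.
Qed.

(** * Necessity of the criterion *)

Section Necessity.
Variable E : {vspace 'cV[R[i]]_N}.
Hypothesis E_DFS : is_DFS M Heff lam J E.

Lemma DFS_jump_unit (v : 'cV[R[i]]_N) (l : 'I_m) : v \in E ->
  v ^t* *m v = 1%:M -> (l < M)%N -> J l *m v = v *m (v ^t* *m (J l *m v)).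
Proof.
move=> v_in v1 lM; have [rho sol rho0] := master_solution_exists (v *m v ^t*).
have rho0_pure : pure_states E (rho 0) by exists v.
have [_ /(_ 0 (lexx 0))[_ dtr]] := E_DFS sol rho0_pure.
have drho : mx_has_deriv rho 0 (master_rhs M Heff lam J (rho 0)).
  exact: sol 0 (lexx 0).
have := has_deriv_unique dtr (has_deriv_mxtrace (mx_has_deriv_mul drho drho)).
rewrite linearD /= [\tr (_ *m rho 0)]mxtrace_mulC rho0 purity_rate //.
set S := \sum_(_ < _ | _) _ => /esym /eqP.
rewrite -mulr2n mulrn_eq0 /= oppr_eq0 => /eqP S0.
(* A vanishing sum of nonnegative terms has only zero terms. *)
have := psumr_eq0P _ S0 lM => /= /(_ _) S_l.
have /eqP : (lam l)%:C * ((J l *m v - v *m (v ^t* *m (J l *m v))) ^t* *m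
    (J l *m v - v *m (v ^t* *m (J l *m v)))) 0 0 = 0.
  apply: S_l => k kM; rewrite mulr_ge0 ?adjmx_mul_ge0 //.
  by rewrite ler0c ltW // lam_gt0.
rewrite mulf_eq0 adjmx_mul_eq0 subr_eq0 => /orP[/eqP lam0|/eqP //].
have := lam_gt0 lM; have /(congr1 (@complex.Re R)) /= -> := lam0.
by rewrite ltxx.
Qed.

Lemma DFS_jump_eigenvalue :
  exists c : 'I_m -> R[i], forall (l : 'I_m) (v : 'cV[R[i]]_N),
    (l < M)%N -> v \in E -> J l *m v = c l *: v.
Proof.
suff eig (l : 'I_m) : exists a, forall v : 'cV[R[i]]_N,
    (l < M)%N -> v \in E -> J l *m v = a *: v.
  by have [c Jc] := choice eig; exists c.
(* For indices outside the jump range the eigenvalue is set to the default 0. *)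
have [lM|_] := boolP (l < M)%N; last by exists 0.
have [v v_in|a Ja] := @common_eigenvalue _ _ (J l) E; last first.
  by exists a => v _; exact: Ja.
have [->|v_neq0] := eqVneq v 0; first by exists 0; rewrite mulmx0 scaler0.
have [a [u [u_in u1 ->]]] := unit_multiple v_in v_neq0.
exists ((u ^t* *m (J l *m u)) 0 0).
by apply: eigenvectorZ; rewrite -mulmx_cV11; exact: DFS_jump_unit.
Qed.

Lemma DFS_invariant (c : 'I_m -> R[i]) :
  (forall (l : 'I_m) (v : 'cV[R[i]]_N),
    (l < M)%N -> v \in E -> J l *m v = c l *: v) ->
  invariant_under (H_ev M Heff lam J c) E.
Proof.
move=> Jc v v_in; have [->|v_neq0] := eqVneq v 0; first by rewrite mulmx0 mem0v.
have [a [u [u_in u1 ->]]] := unit_multiple v_in v_neq0.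
rewrite -scalemxAr memvZ //.
have [rho sol rho0] := master_solution_exists (u *m u ^t*).
have rho0_pure : pure_states E (rho 0) by exists u.
have [_ rho_pure] := E_DFS sol rho0_pure.
have [Q QE] := vspace_annihilator E.
(* With [rho t = w w^+], the vector [rho t *m u] is a multiple of [w], which lies in [E]. *)
have Qrho (t : R) : 0 <= t -> Q (rho t *m u) = 0.
  move=> t_ge0; apply/QE; have [[w [w_in _ ->]] _] := rho_pure t t_ge0.
  by rewrite -mulmxA mulmx_cV11 memvZ.
have drho : mx_has_deriv rho 0 (master_rhs M Heff lam J (rho 0)).
  exact: sol 0 (lexx 0).
have dQ := mx_has_deriv_linear Q (mx_has_deriv_linear (mulmxr u) drho).
(* This is the derivative at 0 of a function that vanishes for all nonnegative times. *)
have /QE : Q (master_rhs M Heff lam J (rho 0) *m u) = 0.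
  apply/matrixP => i j; rewrite [RHS]mxE.
  by apply: has_deriv0_eq0_right (dQ i j) _ => t t_ge0; rewrite /= Qrho // mxE.
have Ju (l : 'I_m) (lM : (l < M)%N) := Jc l u lM u_in.
by rewrite rho0 (master_rhs_eigen Heff lam Ju); exact: commutator_outer_mem.
Qed.

End Necessity.

(** * Sufficiency of the criterion *)

Section Sufficiency.
Variables (K : nat) (psi : K.-tuple 'cV[R[i]]_N) (c : 'I_m -> R[i]).
Hypothesis psi_crit : DFS_criterion M Heff lam J psi c.
Let H := H_ev M Heff lam J c.

Lemma criterion_eigenvalue (l : 'I_m) (v : 'cV[R[i]]_N) :
  (l < M)%N -> v \in <<psi>>%VS -> J l *m v = c l *: v.
Proof.
move=> lM /coord_span ->; rewrite mulmx_sumr scaler_sumr.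
apply: eq_bigr => k _; apply: eigenvectorZ.
by rewrite -tnth_nth; exact: psi_crit.1.
Qed.

(* On the invariant subspace [H] acts through a matrix [h] in the coordinates
   given by [psi], so the Schroedinger flow of [h] stays in the subspace. *)
Lemma schroedinger_in_span (v : 'cV[R[i]]_N) : v \in <<psi>>%VS ->
  exists u : R -> 'cV[R[i]]_N, [/\ u 0 = v,
    forall t, mx_has_deriv u t (- 'i *: (H *m u t)) &
    forall t, u t \in <<psi>>%VS].
Proof.
move=> v_in.
(* The columns of [Psi] are the vectors of [psi], so [Psi] maps coordinates to vectors of the
   span. *)
pose Psi : 'M[R[i]]_(N, K) := \matrix_(i, k) tnth psi k i 0.
pose h : 'M[R[i]]_K := \matrix_(j, k) coord psi j (H *m tnth psi k).
have PsiE (a : 'cV[R[i]]_K) : Psi *m a = \sum_k a k 0 *: tnth psi k.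
  apply/matrixP => i j; rewrite (ord1 j) mxE summxE; apply: eq_bigr => k _.
  by rewrite !mxE mulrC.
have Psi_in a : Psi *m a \in <<psi>>%VS.
  by rewrite PsiE memv_suml // => k _; rewrite memvZ // memv_span // mem_tnth.
have Psi_col k : col k Psi = tnth psi k.
  by apply/matrixP => i j; rewrite (ord1 j) !mxE.
(* This intertwining carries solutions of the [h] equation to solutions of the [H] equation. *)
have Psi_h : H *m Psi = Psi *m h.
  suff Psi_h_col k : col k (H *m Psi) = col k (Psi *m h).
    apply/matrixP => i k; have /matrixP/(_ i 0) := Psi_h_col k.
    by rewrite [LHS]mxE [RHS]mxE.
  rewrite !colE -!mulmxA -!colE Psi_col PsiE.
  have Hpsi_in : H *m tnth psi k \in <<psi>>%VS.
    by apply: psi_crit.2; rewrite memv_span // mem_tnth.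
  rewrite [LHS](coord_span Hpsi_in); apply: eq_bigr => j _.
  by rewrite !mxE -tnth_nth.
have [a [a0 da]] := mx_linear_ode_exists (mulmx (- 'i *: h))
  (\col_k coord psi k v).
exists (fun t => Psi *m a t); split=> [|t|t]; last exact: Psi_in.
  rewrite a0 PsiE [RHS](coord_span v_in); apply: eq_bigr => k _.
  by rewrite mxE -tnth_nth.
have -> : - 'i *: (H *m (Psi *m a t)) = Psi *m (- 'i *: h *m a t).
  by rewrite -scalemxAl -scalemxAr !mulmxA Psi_h.
by have := mx_has_deriv_linear (mulmx Psi) (da t).
Qed.

Lemma schroedinger_norm (u : R -> 'cV[R[i]]_N) :
  (forall t, mx_has_deriv u t (- 'i *: (H *m u t))) ->
  forall t : R, 0 <= t -> (u t) ^t* *m u t = (u 0) ^t* *m u 0.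
Proof.
move=> du; pose n t := (u t) ^t* *m u t.
(* The squared norm has zero derivative, so it and the constant [n 0] both solve the system of the
   zero map. *)
apply: (mx_linear_ode_unique (f := mulmx 0) (X := n) (Y := fun=> n 0)) => //.
  move=> t _; rewrite /= mul0mx.
  have := mx_has_deriv_mul (mx_has_deriv_adj (du t)) (du t).
  congr mx_has_deriv; apply/schroedinger_norm_rate; exact: H_ev_adj.
move=> t _ i j; rewrite /= mul0mx [X in has_deriv _ _ X]mxE.
exact: has_deriv_cst.
Qed.

Lemma schroedinger_master (u : R -> 'cV[R[i]]_N) :
  (forall t, mx_has_deriv u t (- 'i *: (H *m u t))) ->
  (forall t, u t \in <<psi>>%VS) ->
  master_solution M Heff lam J (fun t => u t *m (u t) ^t*).
Proof.
move=> du u_in t _.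
have Ju (l : 'I_m) (lM : (l < M)%N) := criterion_eigenvalue lM (u_in t).
rewrite (master_rhs_eigen Heff lam Ju).
have := mx_has_deriv_mul (du t) (mx_has_deriv_adj (du t)).
congr mx_has_deriv; apply/schroedinger_outer_rate; exact: H_ev_adj.
Qed.

Lemma criterion_DFS : is_DFS M Heff lam J <<psi>>%VS.
Proof.
move=> rho sol [v [v_in v1 rho0]].
have [u [u0 du u_in]] := schroedinger_in_span v_in.
have u1 (t : R) : 0 <= t -> (u t) ^t* *m u t = 1%:M.
  by move=> t_ge0; rewrite schroedinger_norm // u0.
(* Uniqueness identifies an arbitrary solution with the outer product of the Schroedinger flow. *)
have rho_u (t : R) : 0 <= t -> rho t = u t *m (u t) ^t*.
  have := mx_linear_ode_unique sol (schroedinger_master du u_in).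
  by apply; rewrite rho0 u0.
have purity (t : R) : 0 <= t -> \tr (rho t *m rho t) = 1.
  move=> t_ge0; rewrite rho_u // mulmxA -[u t *m _ *m u t]mulmxA u1 // mulmx1.
  by rewrite mxtrace_mulC u1 // mxtrace1.
split=> [|t t_ge0]; first exact: purity.
split; first by exists (u t); rewrite u1 // rho_u.
have drho : mx_has_deriv rho t (master_rhs M Heff lam J (rho t)) := sol t t_ge0.
have := has_deriv_mxtrace (mx_has_deriv_mul drho drho).
have Ju (l : 'I_m) (lM : (l < M)%N) := criterion_eigenvalue lM (u_in t).
rewrite rho_u // (master_rhs_eigen Heff lam Ju).
by rewrite commutator_purity_rate.
Qed.

End Sufficiency.
End DecoherenceFree.

(** * Characterization of decoherence-free subspaces and states *)

Lemma DFS_criterion_exists (R : realType) (N m M : nat) (Heff : 'M[R[i]]_N)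
    (lam : 'I_m -> R) (J : 'I_m -> 'M[R[i]]_N) (K : nat)
    (psi : K.-tuple 'cV[R[i]]_N) :
  (forall l : 'I_m, (l < M)%N -> 0 < lam l) ->
  is_DFS M Heff lam J <<psi>>%VS -> exists c, DFS_criterion M Heff lam J psi c.
Proof.
move=> lam_gt0 psi_DFS; have [c Jc] := DFS_jump_eigenvalue lam_gt0 psi_DFS.
exists c; split=> [l k lM|]; last exact: DFS_invariant psi_DFS _ Jc.
by apply: Jc; rewrite ?memv_span ?mem_tnth.
Qed.

(** The last two equivalences render the claims that all DFS are identified and all DF states are
    constructed explicitly. *)
Theorem theorem6 (R : realType) (N : nat) (N_gt0 : (0 < N)%N)
    (Heff : 'M[R[i]]_N) (Heff_herm : Heff \is hermsymmx)
    (A b : 'M[R[i]]_(N ^ 2 - 1)) (A_psd : psdmx A)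
    (lam : 'I_(N ^ 2 - 1) -> R) (b_diag : diagonalizes b A lam)
    (M : nat) (M_le : (M <= N ^ 2 - 1)%N)
    (lam_pos : forall l : 'I_(N ^ 2 - 1), (0 < lam l) = (l < M)%N)
    (F : 'I_(N ^ 2 - 1) -> 'M[R[i]]_N)
    (F_basis : basis_of fullv (1%:M :: codom F)) :
  let J := jump_op b F in
  [/\ forall (K : nat) (psi : K.-tuple 'cV[R[i]]_N), free psi ->
        (is_DFS M Heff lam J <<psi>>%VS <->
         exists c : 'I_(N ^ 2 - 1) -> R[i], DFS_criterion M Heff lam J psi c),
      forall E : {vspace 'cV[R[i]]_N},
        is_DFS M Heff lam J E <->
        exists (K : nat) (psi : K.-tuple 'cV[R[i]]_N)
            (c : 'I_(N ^ 2 - 1) -> R[i]),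
          basis_of E psi /\ DFS_criterion M Heff lam J psi c
    & forall rho : 'M[R[i]]_N,
        is_DF_state M Heff lam J rho <->
        exists (K : nat) (psi : K.-tuple 'cV[R[i]]_N)
            (c : 'I_(N ^ 2 - 1) -> R[i]) (a : 'I_K -> R[i]),
          let v := \sum_(k < K) a k *: tnth psi k in
          [/\ free psi, DFS_criterion M Heff lam J psi c,
              v ^t* *m v = 1%:M & rho = v *m v ^t*]].
Proof.
move=> J.
have lam_gt0 (l : 'I_(N ^ 2 - 1)) : (l < M)%N -> 0 < lam l by rewrite lam_pos.
have psi_iff K (psi : K.-tuple 'cV[R[i]]_N) : is_DFS M Heff lam J <<psi>>%VS <->
    exists c, DFS_criterion M Heff lam J psi c.
  by split=> [|[c]]; [exact: DFS_criterion_exists | exact: criterion_DFS].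
have E_iff (E : {vspace 'cV[R[i]]_N}) : is_DFS M Heff lam J E <->
    exists (K : nat) (psi : K.-tuple 'cV[R[i]]_N) (c : 'I_(N ^ 2 - 1) -> R[i]),
      basis_of E psi /\ DFS_criterion M Heff lam J psi c.
  split=> [E_DFS|[K [psi [c [/span_basis <- psi_crit]]]]].
    have := E_DFS; rewrite -{1}(span_basis (vbasisP E)) => /psi_iff[c c_crit].
    by exists (\dim E), (vbasis E), c; split; first exact: vbasisP.
  by apply/psi_iff; exists c.
split=> // rho; split=> [[E /E_iff[K [psi [c [psi_basis psi_crit]]]]]|].
  (* The amplitudes are the coordinates of [v] in the basis that satisfies the criterion. *)
  move=> [v [v_in v1 ->]]; exists K, psi, c, (fun k => coord psi k v) => /=.
  have <- : v = \sum_(k < K) coord psi k v *: tnth psi k.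
    rewrite [LHS](coord_basis psi_basis v_in); apply: eq_bigr => k _.
    by rewrite -tnth_nth.
  by split=> //; exact: basis_free psi_basis.
move=> [K [psi [c [a [psi_free psi_crit v1 ->]]]]].
exists <<psi>>%VS; first by apply/psi_iff; exists c.
exists (\sum_(k < K) a k *: tnth psi k); split=> //.
by rewrite memv_suml // => k _; rewrite memvZ // memv_span // mem_tnth.
Qed.
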